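(* Let $n\ge 4$ and let $A_n$ be the complex $(n-1)$-ary Filippov algebra with basis $e_1,\dots,e_n$ and totally antisymmetric multilinear product determined by $[e_1,\dots,\hat e_i,\dots,e_n]=(-1)^{n+i}e_i$ for $i=1,\dots,n$. Then every $2$-local derivation of $A_n$ is a derivation of $A_n$ (in particular, it is linear).
   Context: The base field is $\mathbb{C}$. An $m$-ary algebra is a vector space with an $m$-linear operation $[\cdot,\dots,\cdot]$. The symbol $\hat e_i$ means that $e_i$ is omitted from the product. ''Antisymmetric'' means that the product changes sign under transposition of any two arguments, so it vanishes if two arguments coincide. A Filippov algebra is an algebra with one antisymmetric $m$-ary operation satisfying $[[x_1,\dots,x_m],y_2,\dots,y_m]=\sum_{i=1}^m[x_1,\dots,[x_i,y_2,\dots,y_m],\dots,x_m]$. (The algebra $A_n$ is one, with $m=n-1$.) A derivation of an $m$-ary algebra $\mathbf{A}$ is a linear map $D:\mathbf{A}\to\mathbf{A}$ with $D([x_1,\dots,x_m])=\sum_{i=1}^m[x_1,\dots,D(x_i),\dots,x_m]$ for all $x_1,\dots,x_m\in\mathbf{A}$. A $2$-local derivation of $\mathbf{A}$ is a (not necessarily linear) map $\Delta:\mathbf{A}\to\mathbf{A}$ such that for any two elements $x,y\in\mathbf{A}$ there exists a derivation $D_{x,y}$ of $\mathbf{A}$ (depending on $x,y$) with $\Delta(x)=D_{x,y}(x)$ and $\Delta(y)=D_{x,y}(y)$. *)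

(* Defs.v *)
From mathcomp Require Import all_boot perm all_algebra.
From mathcomp Require Import reals complex.

Set Implicit Arguments.
Unset Strict Implicit.
Unset Printing Implicit Defensive.

Import GRing.Theory.
Local Open Scope ring_scope.

Section MaryAlgebra.
Variables (K : fieldType) (V : lmodType K) (m : nat).

Definition mary_op := {ffun 'I_m -> V} -> V.

Definition subst_arg (x : {ffun 'I_m -> V}) (i : 'I_m) (v : V) :
    {ffun 'I_m -> V} :=
  [ffun j => if j == i then v else x j].

Definition multilinear_op (mu : mary_op) : Prop :=
  forall (x : {ffun 'I_m -> V}) (i : 'I_m),
    linear (fun v => mu (subst_arg x i v)).

(* When 2 is invertible in K, as over the complex numbers, this forces mu to
   vanish as soon as two arguments coincide. *)
Definition antisymmetric_op (mu : mary_op) : Prop :=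
  forall (x : {ffun 'I_m -> V}) (i j : 'I_m), i != j ->
    mu [ffun k => x (tperm i j k)] = - mu x.

Definition derivation (mu : mary_op) (D : V -> V) : Prop :=
  linear D /\
  forall x : {ffun 'I_m -> V},
    D (mu x) = \sum_(i < m) mu (subst_arg x i (D (x i))).

Definition two_local_derivation (mu : mary_op) (Delta : V -> V) : Prop :=
  forall x y : V, exists D : V -> V,
    [/\ derivation mu D, Delta x = D x & Delta y = D y].

End MaryAlgebra.

(* The Filippov identity is a consequence of these conditions and is not imposed.
   With i : 'I_n counted from 0, the omitted vector is the (i + 1)-st one, so
   the sign (-1)^(n + i) of the 1-based table is (-1) ^+ (n + i.+1) here, and
   j |-> lift i j enumerates in increasing order the indices other than i. *)
Definition is_An (K : fieldType) (V : vectType K) (n : nat)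
    (e : n.-tuple V) (mu : mary_op V n.-1) : Prop :=
  [/\ basis_of fullv e,
      multilinear_op mu,
      antisymmetric_op mu &
      forall i : 'I_n,
        mu [ffun j => tnth e (lift i j)] = (-1) ^+ (n + i.+1) *: tnth e i].

(* Main.v *)
From HB Require Import structures.
Require Import Defs.
From mathcomp Require Import all_boot perm all_algebra.
From mathcomp Require Import reals complex ring.

Local Open Scope ring_scope.

Set Implicit Arguments.
Unset Strict Implicit.
Unset Printing Implicit Defensive.
Import GRing.Theory Num.Theory.

(** The algebra A_n is the generalized cross product: if (_, _) is the bilinear
    form for which e_1, ..., e_n is orthonormal, then
    ([x_1, ..., x_(n-1)], y) = det (x_1, ..., x_(n-1), y).  Both sides are
    multilinear and alternating in the x_i, so it is enough to compare them on
    the increasing tuples of basis vectors ([is_An_unique], [det_op_is_An],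
    [An_dot]).

    Every linear D satisfies
    sum_i det (w_1, ..., D w_i, ..., w_n) = tr D * det (w_1, ..., w_n)
    ([vol_trace]), which reads in terms of the product
    (sum_j [x_1, ..., D x_j, ..., x_(n-1)], y) + ([x], D y) = tr D * ([x], y)
    ([An_trace]).  If D is skew, then tr D = 0 and this says that D is a
    derivation.  If D is a derivation, it says that
    (D z, y) + (z, D y) = tr D * (z, y) for each product z, hence for all z since
    the e_i are products; taking z = y = e_i and summing over i gives
    2 tr D = n tr D, so tr D = 0 and D is skew.  The derivations of A_n are
    therefore exactly the skew maps ([An_derivationP]).

    Being skew involves two vectors at a time: (Delta x, y) = - (x, Delta y)
    only mentions the values of Delta at x and y, where Delta agrees with a
    single derivation.  So a 2-local derivation is skew, and a skew map is
    automatically linear because the form is nondegenerate ([skew_linear]). *)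

(** * Linear combinations and argument families *)

Lemma linear_comb (K : fieldType) (V W : lmodType K) (f : V -> W)
    (I : finType) (c : I -> K) (b : I -> V) :
  linear f -> f (\sum_i c i *: b i) = \sum_i c i *: f (b i).
Proof.
move=> f_lin.
pose F : {linear V -> W} := HB.pack f (GRing.isLinear.Build _ _ _ _ f f_lin).
rewrite -[f]/(F : V -> W) linear_sum.
by apply: eq_bigr => i _; rewrite linearZ.
Qed.

Section SubstArg.
Variables (K : fieldType) (V : lmodType K) (m : nat).
Implicit Types (x : {ffun 'I_m -> V}) (i : 'I_m).

Lemma subst_arg_id x i : subst_arg x i (x i) = x.
Proof. by apply/ffunP => j; rewrite ffunE; case: eqP => [->|]. Qed.

Definition snoc_arg x (y : V) : {ffun 'I_m.+1 -> V} :=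
  [ffun i => if unlift ord_max i is Some j then x j else y].

Lemma subst_snoc_lift x y i v :
  subst_arg (snoc_arg x y) (lift ord_max i) v = snoc_arg (subst_arg x i v) y.
Proof.
apply/ffunP => k; rewrite !ffunE.
case: unliftP => [j ->|->]; last by rewrite (negbTE (neq_lift _ _)).
by rewrite ffunE (inj_eq lift_inj).
Qed.

Lemma subst_snoc_max x y v :
  subst_arg (snoc_arg x y) ord_max v = snoc_arg x v.
Proof.
apply/ffunP => k; rewrite !ffunE.
case: unliftP => [j ->|->]; last by rewrite eqxx.
by rewrite eq_sym (negbTE (neq_lift _ _)).
Qed.

End SubstArg.

(** * The orthonormal form, skew maps and the volume form of a basis *)

Section Coordinates.
Variables (K : numFieldType) (V : vectType K) (n : nat) (e : n.-tuple V).
Hypothesis e_basis : basis_of fullv e.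

Definition dot (x y : V) : K := \sum_i coord e i x * coord e i y.

Lemma coord_sum_tnth v : v = \sum_i coord e i v *: tnth e i.
Proof.
rewrite {1}(coord_basis e_basis (memvf v)).
by apply: eq_bigr => i _; rewrite (tnth_nth 0).
Qed.

Lemma coord_tnth i j : coord e i (tnth e j) = (i == j)%:R.
Proof. by rewrite (tnth_nth 0) coord_free ?(basis_free e_basis) // eq_sym. Qed.

Lemma dotC x y : dot x y = dot y x.
Proof. by apply: eq_bigr => i _; rewrite mulrC. Qed.

Lemma dot_tnth x i : dot x (tnth e i) = coord e i x.
Proof.
rewrite /dot (bigD1 i) //= coord_tnth eqxx mulr1 big1 ?addr0 // => j ji.
by rewrite coord_tnth (negbTE ji) mulr0.
Qed.

Lemma dot_linearl a u v y : dot (a *: u + v) y = a * dot u y + dot v y.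
Proof.
rewrite /dot mulr_sumr -big_split; apply: eq_bigr => i _ /=.
by rewrite linearP mulrDl mulrA.
Qed.

Lemma dotZl a u y : dot (a *: u) y = a * dot u y.
Proof.
by rewrite /dot mulr_sumr; apply: eq_bigr => i _; rewrite linearZ mulrA.
Qed.

Lemma dot_inj x y : (forall z, dot x z = dot y z) -> x = y.
Proof.
move=> xy; rewrite (coord_sum_tnth x) (coord_sum_tnth y).
by apply: eq_bigr => i _; rewrite -!dot_tnth xy.
Qed.

Lemma linear_eq_basis (W : lmodType K) (f g : V -> W) :
  linear f -> linear g -> (forall i, f (tnth e i) = g (tnth e i)) -> f =1 g.
Proof.
move=> f_lin g_lin fg v; rewrite (coord_sum_tnth v) !linear_comb //.
by apply: eq_bigr => i _; rewrite fg.
Qed.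

Definition skew (f : V -> V) := forall x y, dot (f x) y = - dot x (f y).

(** Moving f to the other argument of the form leaves an expression that is
    linear in the first argument by bilinearity of the form alone. *)
Lemma skew_linear f : skew f -> linear f.
Proof.
move=> f_skew a u v; apply: dot_inj => z.
by rewrite f_skew !dot_linearl !f_skew opprD mulrN.
Qed.

Definition coord_mx (w : {ffun 'I_n -> V}) : 'M[K]_n :=
  \matrix_(i, k) coord e k (w i).

Definition vol (w : {ffun 'I_n -> V}) : K := \det (coord_mx w).

Definition basis_trace (D : V -> V) : K := \sum_i coord e i (D (tnth e i)).

(** Laplace expansion along row i, whose cofactors do not see the entry w i. *)
Lemma vol_subst (w : {ffun 'I_n -> V}) i v :
  vol (subst_arg w i v) = \sum_k coord e k v * cofactor (coord_mx w) i k.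
Proof.
rewrite /vol (expand_det_row _ i); apply: eq_bigr => k _.
rewrite mxE ffunE eqxx; congr (_ * (_ * \det _)).
by apply/matrixP => j l; rewrite !mxE ffunE eq_sym (negbTE (neq_lift _ _)).
Qed.

Lemma vol_linear (w : {ffun 'I_n -> V}) i a u v :
  vol (subst_arg w i (a *: u + v)) =
  a * vol (subst_arg w i u) + vol (subst_arg w i v).
Proof.
rewrite !vol_subst mulr_sumr -big_split; apply: eq_bigr => k _ /=.
by rewrite linearP mulrDl [a * (_ * _)]mulrA.
Qed.

Lemma vol_tperm (w : {ffun 'I_n -> V}) i j :
  i != j -> vol [ffun k => w (tperm i j k)] = - vol w.
Proof.
move=> ij; rewrite /vol.
have -> : coord_mx [ffun k => w (tperm i j k)] = xrow i j (coord_mx w).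
  by apply/matrixP => k l; rewrite !mxE ffunE.
by rewrite /xrow row_permE det_mulmx det_perm odd_tperm ij mulN1r.
Qed.

(** The infinitesimal form of det (A M) = det A * det M.  With A the matrix of w
    and M that of D, expanding each summand along the changed row gives the trace
    of (A M) adj A, which equals tr (M (adj A) A) by cyclicity. *)
Lemma vol_trace (D : V -> V) (w : {ffun 'I_n -> V}) : linear D ->
  \sum_i vol (subst_arg w i (D (w i))) = basis_trace D * vol w.
Proof.
move=> D_lin; pose M : 'M[K]_n := \matrix_(j, k) coord e k (D (tnth e j)).
have -> : basis_trace D = \tr M by apply: eq_bigr => i _; rewrite mxE.
transitivity (\tr ((coord_mx w *m M) *m \adj (coord_mx w))).
  rewrite /mxtrace; apply: eq_bigr => i _; rewrite vol_subst [RHS]mxE.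
  apply: eq_bigr => k _.
  rewrite !mxE; congr (_ * _).
  rewrite {1}(coord_sum_tnth (w i)) linear_comb // linear_sum.
  by apply: eq_bigr => j _; rewrite linearZ !mxE.
by rewrite -mulmxA mxtrace_mulC -mulmxA mul_adj_mx mul_mx_scalar mxtraceZ mulrC.
Qed.

End Coordinates.

(** * Antisymmetric multilinear operations are determined on a basis *)

Section Multilinear.
Variables (K : numFieldType) (V : vectType K) (n m : nat) (e : n.+1.-tuple V).

Lemma antisymmetric_repeat (mu : mary_op V m) (x : {ffun 'I_m -> V}) i j :
  antisymmetric_op mu -> i != j -> x i = x j -> mu x = 0.
Proof.
move=> mu_anti ij xij; apply/eqP; move: (mu_anti x i j ij).
have -> : [ffun k => x (tperm i j k)] = x.
  by apply/ffunP => k; rewrite ffunE; case: tpermP => // ->.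
by move/eqP; rewrite -addr_eq0 -mulr2n -scaler_nat scaler_eq0 pnatr_eq0.
Qed.

(** The signs that a permutation of the arguments produces are the same for both
    operations, so an induction over a product of transpositions transports the
    equality without computing them. *)
Lemma antisymmetric_eq_perm (mu nu : mary_op V m) (x : {ffun 'I_m -> V})
    (s : 'S_m) :
  antisymmetric_op mu -> antisymmetric_op nu -> mu x = nu x ->
  mu [ffun k => x (s k)] = nu [ffun k => x (s k)].
Proof.
move=> mu_anti nu_anti mu_nu; have [ts -> ts_neq] := prod_tpermP s.
elim: ts ts_neq => [_|[i j] ts IHts /= /andP[ij /IHts{}IHts]].
  have -> // : [ffun k => x ((\prod_(t <- [::]) tperm t.1 t.2)%g k)] = x.
  by apply/ffunP => k; rewrite ffunE big_nil perm1.
rewrite big_cons /=; set t := (\prod_(_ <- _) _)%g in IHts *.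
have -> : [ffun k => x ((tperm i j * t)%g k)] =
          [ffun k => [ffun k' => x (t k')] (tperm i j k)].
  by apply/ffunP => k; rewrite !ffunE permM.
by rewrite mu_anti // nu_anti // IHts.
Qed.

(** The arguments are freed one at a time: at stage k the first k arguments are
    arbitrary and the others are basis vectors. *)
Lemma multilinear_eq_basis (mu nu : mary_op V m) :
  basis_of fullv e -> multilinear_op mu -> multilinear_op nu ->
  (forall f : 'I_m -> 'I_n.+1,
     mu [ffun k => tnth e (f k)] = nu [ffun k => tnth e (f k)]) ->
  mu =1 nu.
Proof.
move=> e_basis mu_lin nu_lin mu_nu x.
pose mix k (f : 'I_m -> 'I_n.+1) : {ffun 'I_m -> V} :=
  [ffun j : 'I_m => if (j < k)%N then x j else tnth e (f j)].
have mix_eq k f : (k <= m)%N -> mu (mix k f) = nu (mix k f).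
  elim: k f => [|k IHk] f km; first exact: mu_nu.
  pose i := Ordinal km.
  rewrite -[mix k.+1 f](subst_arg_id _ i).
  apply: (linear_eq_basis e_basis (mu_lin _ i) (nu_lin _ i)) => l.
  have -> : subst_arg (mix k.+1 f) i (tnth e l) =
            mix k (fun j => if j == i then l else f j).
    apply/ffunP => j; rewrite !ffunE ltnS leq_eqVlt.
    have -> : (j == k :> nat) = (j == i) by [].
    by case: eqP => [->|_] //=; rewrite ltnn.
  by apply: IHk; apply: ltnW.
(* At stage m no basis vector is left, so the choice of f is immaterial. *)
suff <- : mix m (fun=> ord0) = x by apply: mix_eq.
by apply/ffunP => j; rewrite ffunE ltn_ord.
Qed.

End Multilinear.

(** * The product as a determinant, and its derivations *)

Section An.
Variables (K : numFieldType) (V : vectType K) (m : nat) (e : m.+1.-tuple V).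

(** An injective f misses an index i, so it is the increasing enumeration of the
    other indices up to a permutation. *)
Lemma injective_lift (f : 'I_m -> 'I_m.+1) : injective f ->
  exists (i : 'I_m.+1) (s : 'S_m), forall k, f k = lift i (s k).
Proof.
move=> f_inj.
have [i iNf] : exists i, i \notin codom f.
  apply/existsP; rewrite -negb_forall; apply/negP => /forallP f_onto.
  have : (#|'I_m.+1| <= #|'I_m|)%N.
    rewrite -(card_codom f_inj).
    by apply/subset_leq_card/subsetP => k _; apply: f_onto.
  by rewrite !card_ord ltnn.
have if_neq k : i != f k by apply: contraNneq iNf => ->; apply: codom_f.
pose g k := s2val (unlift_some (if_neq k)).
have gE k : f k = lift i (g k) by apply: (s2valP (unlift_some (if_neq k))).
have g_inj : injective g by move=> k l gkl; apply: f_inj; rewrite !gE gkl.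
by exists i, (perm g_inj) => k; rewrite permE gE.
Qed.

(** A tuple of basis vectors either has a repetition, where both products vanish,
    or is a permutation of one of the tuples in the multiplication table. *)
Lemma is_An_unique (mu nu : mary_op V m) :
  is_An e mu -> is_An e nu -> mu =1 nu.
Proof.
case=> e_basis mu_lin mu_anti mu_e [_ nu_lin nu_anti nu_e].
apply: (multilinear_eq_basis e_basis mu_lin nu_lin) => f.
have [/injectiveP /injective_lift[i [s fE]]|] := boolP (injectiveb f).
  have -> : [ffun k => tnth e (f k)] =
            [ffun k => [ffun j => tnth e (lift i j)] (s k)].
    by apply/ffunP => k; rewrite !ffunE fE.
  by apply: antisymmetric_eq_perm; rewrite // mu_e nu_e.
case/injectivePn => i [j ij fij].
by rewrite !(@antisymmetric_repeat _ _ _ _ _ i j) // !ffunE fij.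
Qed.

(** The generalized cross product: the vector whose inner product with y is
    det (x_1, ..., x_m, y). *)
Definition det_op : mary_op V m :=
  fun x => \sum_k vol e (snoc_arg x (tnth e k)) *: tnth e k.

Hypothesis e_basis : basis_of fullv e.

Lemma coord_det_op (x : {ffun 'I_m -> V}) k :
  coord e k (det_op x) = vol e (snoc_arg x (tnth e k)).
Proof.
rewrite linear_sum (bigD1 k) //= linearZ /= coord_tnth // eqxx.
rewrite big1 ?addr0 => [|i ik]; first exact: mulr1.
by rewrite linearZ /= coord_tnth // eq_sym (negbTE ik) mulr0.
Qed.

Lemma dot_det_op (x : {ffun 'I_m -> V}) y :
  dot e (det_op x) y = vol e (snoc_arg x y).
Proof.
rewrite -(subst_snoc_max x 0 y) vol_subst; apply: eq_bigr => k _.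
rewrite mulrC coord_det_op -(subst_snoc_max x 0) vol_subst (bigD1 k) //=.
rewrite coord_tnth // eqxx mul1r big1 ?addr0 // => i ik.
by rewrite coord_tnth // (negbTE ik) mul0r.
Qed.

(** For k <> i the last row repeats an earlier one.  For k = i the only nonzero
    entry of the last row is a 1 in column i; its minor is an identity matrix, and
    the sign is that of the cofactor in row m and column i. *)
Lemma vol_snoc_basis i k :
  vol e (snoc_arg [ffun j => tnth e (lift i j)] (tnth e k)) =
  (k == i)%:R * (-1) ^+ (m + i).
Proof.
case: eqP => [->|/eqP]; last first.
  rewrite eq_sym mul0r => /unlift_some[j kE _].
  apply: (@determinant_alternate _ _ _ ord_max (lift ord_max j)).
    exact: neq_lift.
  by move=> l; rewrite !mxE !ffunE unlift_none liftK ffunE kE.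
rewrite -(subst_snoc_max _ 0) vol_subst (bigD1 i) //= coord_tnth // eqxx.
rewrite big1 ?addr0 => [|l li]; last by rewrite coord_tnth // (negbTE li) mul0r.
congr (_ * _); rewrite /cofactor.
have -> : row' ord_max (col' i (coord_mx e
    (snoc_arg [ffun j => tnth e (lift i j)] 0))) = 1%:M.
  apply/matrixP => j l; rewrite !mxE !ffunE liftK ffunE coord_tnth //.
  by rewrite (inj_eq lift_inj) eq_sym.
by rewrite det1 mulr1.
Qed.

Lemma det_op_is_An : is_An e det_op.
Proof.
split=> // [x i a u v|x i j ij|i].
- apply: (dot_inj e_basis) => z.
  by rewrite dot_linearl !dot_det_op -!subst_snoc_lift vol_linear.
- apply: (dot_inj e_basis) => z.
  rewrite -scaleN1r dotZl !dot_det_op mulN1r.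
  rewrite -(vol_tperm e _ (i := lift ord_max i) (j := lift ord_max j));
    last by rewrite (inj_eq lift_inj).
  congr vol; apply/ffunP => k; rewrite !ffunE.
  case: (unliftP ord_max k) => [l ->|->].
    by rewrite ffunE !permE /= !(inj_eq lift_inj) -!(fun_if (lift ord_max)) liftK.
  by rewrite tpermD ?unlift_none // eq_sym neq_lift.
- rewrite /det_op (bigD1 i) //= vol_snoc_basis eqxx mul1r big1 ?addr0.
    by rewrite addSn addnS !exprS !mulN1r opprK.
  by move=> k ki; rewrite vol_snoc_basis (negbTE ki) mul0r scale0r.
Qed.

Lemma An_dot mu (x : {ffun 'I_m -> V}) y :
  is_An e mu -> dot e (mu x) y = vol e (snoc_arg x y).
Proof. by move=> mu_An; rewrite (is_An_unique mu_An det_op_is_An) dot_det_op. Qed.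

(** [vol_trace] for the family (x_1, ..., x_m, y), with the summand of the last
    argument split off. *)
Lemma An_trace mu D (x : {ffun 'I_m -> V}) y : is_An e mu -> linear D ->
  dot e (\sum_j mu (subst_arg x j (D (x j)))) y + dot e (mu x) (D y) =
  basis_trace e D * dot e (mu x) y.
Proof.
move=> mu_An D_lin.
rewrite !(An_dot _ _ mu_An) -(vol_trace e_basis _ D_lin) (bigD1_ord ord_max) //=.
rewrite [RHS]addrC; congr (_ + _); last first.
  by rewrite ffunE unlift_none subst_snoc_max.
transitivity (\sum_j dot e (mu (subst_arg x j (D (x j)))) y).
  rewrite /dot exchange_big; apply: eq_bigr => k _ /=.
  by rewrite linear_sum mulr_suml.
apply: eq_bigr => j _.
by rewrite (An_dot _ _ mu_An) ffunE liftK subst_snoc_lift.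
Qed.

(** For x a product this is [An_trace] with the derivation rule inserted.  The
    basis vectors are products up to sign, and both sides are linear in x. *)
Lemma derivation_dot mu D x y : is_An e mu -> derivation mu D ->
  dot e (D x) y + dot e x (D y) = basis_trace e D * dot e x y.
Proof.
move=> mu_An [D_lin D_der]; case: (mu_An) => _ _ _ mu_e.
apply: (linear_eq_basis e_basis (W := K^o)
  (f := fun x => dot e (D x) y + dot e x (D y))
  (g := fun x => basis_trace e D * dot e x y)) x => [a u v|a u v|i].
- by rewrite D_lin !dot_linearl /GRing.scale /=; ring.
- by rewrite !dot_linearl /GRing.scale /=; ring.
pose s : K := (-1) ^+ (m.+1 + i.+1).
have := An_trace [ffun j => tnth e (lift i j)] y mu_An D_lin.
rewrite -D_der mu_e -/s (scalable_linear D_lin) !dotZl -mulrDr mulrCA.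
by apply: mulfI; rewrite signr_eq0.
Qed.

(** Taking x = y = e_i gives 2 (D e_i, e_i) = tr D; the sum over i is
    2 tr D = (m + 1) tr D.  For m = 1 this is empty, and indeed the conclusion
    fails for the identity of A_2: there mu is a linear map and its derivations
    are the linear maps commuting with it. *)
Lemma derivation_trace0 mu D : (m != 1)%N -> is_An e mu ->
  derivation mu D -> basis_trace e D = 0.
Proof.
move=> m1 mu_An D_der; set t := basis_trace e D.
have t_diag i : coord e i (D (tnth e i)) *+ 2 = t.
  have := derivation_dot (tnth e i) (tnth e i) mu_An D_der.
  by rewrite [X in _ + X]dotC !dot_tnth // coord_tnth // eqxx mulr1 mulr2n.
have : t *+ 2 = t *+ m.+1.
  rewrite -[m.+1]card_ord -sumr_const -sumrMnl.
  by apply: eq_bigr => i _; rewrite t_diag.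
have [//|t_neq0 /(mulrIn t_neq0)[m_eq]] := eqVneq t 0.
by rewrite -m_eq in m1.
Qed.

Lemma An_derivationP mu D : (m != 1)%N -> is_An e mu ->
  derivation mu D <-> skew e D.
Proof.
move=> m1 mu_An; split=> [D_der x y|D_skew].
  apply/eqP; rewrite -addr_eq0 (derivation_dot _ _ mu_An D_der).
  by rewrite (derivation_trace0 m1 mu_An D_der) mul0r.
have D_lin := skew_linear e_basis D_skew.
split=> // x; apply: (dot_inj e_basis) => y.
have t0 : basis_trace e D = 0.
  rewrite /basis_trace big1 // => i _; apply/eqP.
  have := D_skew (tnth e i) (tnth e i).
  rewrite [X in - X]dotC dot_tnth // => /eqP.
  by rewrite -addr_eq0 -mulr2n mulrn_eq0.
apply/eqP; rewrite D_skew eq_sym -addr_eq0.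
by rewrite (An_trace _ _ mu_An D_lin) t0 mul0r.
Qed.

End An.

Theorem theorem5 (R : realType) (n : nat) (hn : (4 <= n)%N)
    (V : vectType R[i]) (e : n.-tuple V) (mu : mary_op V n.-1)
    (hA : is_An e mu) (Delta : V -> V) :
  two_local_derivation mu Delta -> derivation mu Delta.
Proof.
case: n hn e mu hA => // m m_ge3 e mu mu_An Delta_local.
have m_neq1 : m != 1%N by apply: contraTneq m_ge3 => ->.
have [e_basis _ _ _] := mu_An.
have derP D : derivation mu D <-> skew e D by apply: An_derivationP.
apply/derP => x y; have [D [/derP D_skew -> ->]] := Delta_local x y.
exact: D_skew.
Qed.
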